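(* Let $\varrho$ be given by $\varrho([0])=[0][1]$ and $\varrho([i])=[0][i-1][i+1]$ for integers $i>0$, on letters $[i]$, $i\in\mathbb{N}_0$. For $n\geq 0$ let $\#(n)$ be the number of letters of the word $\varrho^n([0])$, and define the discrepancy $d(n)$ by $\#(n)=\frac34\left(\frac52\right)^n+d(n)$. Let $C_i=\frac{1}{i+1}\binom{2i}{i}$ be the $i$-th Catalan number. Then for every integer $k\ge 0$ $$d(2k+1)=\frac12\left(\frac52\right)^{2k}\sum_{i=k+1}^\infty\left(\frac25\right)^{2i}C_i=\frac{2}{25}\left(C_{k+1}+\frac{4}{25}C_{k+2}+\left(\frac{4}{25}\right)^2C_{k+3}+\cdots\right),$$ and for every integer $k\ge 1$, $d(2k)=\frac52\, d(2k-1)$.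
   Context: $\mathbb{N}_0=\{0,1,2,\dots\}$. The substitution $\varrho$ is extended to finite words by concatenation, and $\varrho^n$ denotes its $n$-fold iterate. *)

(* Defs.v *)
From mathcomp Require Import all_boot all_order all_algebra.
From mathcomp Require Import all_classical all_reals all_analysis.

Set Implicit Arguments.
Unset Strict Implicit.
Unset Printing Implicit Defensive.

Import Order.TTheory GRing.Theory Num.Theory.
Import numFieldNormedType.Exports.

Local Open Scope classical_set_scope.
Local Open Scope ring_scope.

(* The letter [i] is represented by the natural number i, a word by a [seq nat]. *)
Definition rho_letter (i : nat) : seq nat :=
  if i is j.+1 then [:: 0%N; j; j.+2] else [:: 0%N; 1%N].

Definition rho (w : seq nat) : seq nat := flatten [seq rho_letter i | i <- w].

Definition nletters (n : nat) : nat := size (iter n rho [:: 0%N]).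

Definition discrepancy (R : realType) (n : nat) : R :=
  (nletters n)%:R - 3 / 4 * (5 / 2) ^+ n.

Definition catalan (R : realType) (i : nat) : R :=
  1 / (i.+1)%:R * 'C(2 * i, i)%:R.

(* Main.v *)
Require Import Defs.
From mathcomp Require Import all_boot all_order all_algebra.
From mathcomp Require Import all_classical all_reals all_analysis.
From mathcomp Require Import ring lra.
From mathcomp Require Import zify.

Import Order.TTheory GRing.Theory Num.Theory.
Import numFieldNormedType.Exports.

Local Open Scope classical_set_scope.
Local Open Scope ring_scope.

(** The matrix of the substitution is the adjacency matrix A of the half line
    0 - 1 - 2 - ... (the letters i-1 and i+1 in the image of i), plus the
    rank-one term that adds a letter 0 to every image.  Powers of A count the
    nonnegative walks: let p_n(i) ([ballot]) be the number of such walks of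
    length n from 0 to i, so that p_2k(0) = C_k and p_(2k+1)(0) = 0.

    Two facts about p_n give the theorem.

    First, the weight w_n(i) = p_n(i) - (p_n(0) + ... + p_n(i-1)) satisfies
    w_(n+1)(i) = sum of w_n over the letters of the image of i ([weightS]): the
    rank-one term contributes w_n(0) = p_n(0), which is exactly the boundary term
    left over when the partial sums of p_(n+1) are computed from those of p_n.
    Hence the total w_0-weight of the n-th iterate of the word 0 is
    w_n(0) = p_n(0).  As w_0(i) = 5 - 2 |image of i|, the word lengths satisfy
    2 #(n+1) = 5 #(n) - p_n(0), that is,
    d(n+1) = (5/2) d(n) - p_n(0)/2 ([discrepancyS]).
    For n odd this is the last claim of the theorem; two steps together give
    d(2k+3) = (25/4) d(2k+1) - C_(k+1)/2, which telescopes into partial sums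
    of the series ([sum_catalan_telescope]).

    Second, the remainder of the telescoped series tends to 0 because d(n) grows
    at most like 2^n, not like (5/2)^n.  The function i |-> 2^-i is an
    eigenfunction of A with eigenvalue 5/2 = 2 + 1/2, except at 0; so
    sum_i p_n(i) 2^-i satisfies, up to the factor 1/4, the same recurrence as d,
    and d(n) = (1/4) sum_i p_n(i) 2^-i ([discrepancy_ballot]), while
    |p_n(i)| <= 2^n. *)

(** * Walks on the half line *)

(** The number of unrestricted walks of length n from 0 to i with steps +1 and
    -1; only endpoints i >= 0 are needed, by symmetry. *)
Definition walks (n i : nat) : nat :=
  if odd (n + i) then 0%N else 'C(n, (n + i)./2).

Lemma walksSS n i : walks n.+1 i.+1 = (walks n i + walks n i.+2)%N.
Proof.
rewrite /walks !addSn !addnS /= !negbK; case: ifP => // _.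
by rewrite binS addnC.
Qed.

(** The two neighbours 1 and -1 of 0 are reached by equally many walks. *)
Lemma walksS0 n : walks n.+1 0 = (walks n 1 + walks n 1)%N.
Proof.
rewrite /walks addn0 addn1 oddS; case: ifP => // /negbFE n_odd.
have [j ->] : exists j, n = j.*2.+1.
  by exists n./2; rewrite -[LHS]odd_double_half n_odd.
rewrite -doubleS doubleK doubleS binS; congr (_ + _)%N.
by rewrite -bin_sub; [congr 'C(_, _)|]; lia.
Qed.

Lemma walks_gt n i : (n < i)%N -> walks n i = 0%N.
Proof.
by move=> n_lt_i; rewrite /walks; case: ifP => // parity; rewrite bin_small //; lia.
Qed.

(** The number of walks that stay nonnegative, by the reflection principle: a walk
    from 0 to i that visits -1 reflects to one from 0 to -i-2. *)
Definition ballot {R : nzRingType} (n i : nat) : R :=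
  (walks n i)%:R - (walks n i.+2)%:R.

Lemma ballotSS (R : nzRingType) n i :
  ballot n.+1 i.+1 = ballot n i + ballot n i.+2 :> R.
Proof. by rewrite /ballot !walksSS !natrD opprD addrACA. Qed.

Lemma ballotS0 (R : nzRingType) n : ballot n.+1 0 = ballot n 1 :> R.
Proof.
by rewrite /ballot walksS0 walksSS !natrD opprD addrA addrK.
Qed.

Lemma ballot_gt (R : nzRingType) n i : (n < i)%N -> ballot n i = 0 :> R.
Proof. by move=> n_lt_i; rewrite /ballot !walks_gt ?subrr //; lia. Qed.

Lemma ballot0 (R : nzRingType) i : ballot 0 i = (i == 0%N)%:R :> R.
Proof.
case: i => [|i]; last by rewrite ballot_gt.
by rewrite /ballot /walks /= subr0.
Qed.

Lemma ballot_odd (R : nzRingType) k : ballot (k.*2.+1) 0 = 0 :> R.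
Proof. by rewrite /ballot /walks !(addSn, addnS, addn0) /= odd_double subrr. Qed.

(** Here p_2k(0) is the difference of the binomial coefficients of 2k at k and
    k+1, and the second one is k/(k+1) times the first. *)
Lemma ballot_catalan (R : realType) k : ballot k.*2 0 = catalan R k.
Proof.
rewrite /ballot /walks /catalan !addnS addn0 /= !negbK odd_double doubleK mul2n.
have /(congr1 (fun m => m%:R : R)) := mul_bin_left k.*2 k.
rewrite -addnn addnK !natrM => bin_succ.
have k1_neq0 : k.+1%:R != 0 :> R by rewrite pnatr_eq0.
apply: (mulfI k1_neq0); rewrite mulrBr bin_succ -addn1 natrD.
by field; rewrite natr1.
Qed.

Lemma ballot_le (R : realType) n i : `|ballot n i : R| <= 2 ^+ n.
Proof.
elim: n i => [|n IHn] [|i].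
- by rewrite ballot0 normr1.
- by rewrite ballot0 normr0.
- by rewrite ballotS0; apply: le_trans (IHn 1%N) _; rewrite ler_weXn2l ?ler1n.
- by rewrite ballotSS exprS mulr_natl mulr2n (le_trans (ler_normD _ _)) ?lerD.
Qed.

(** Each m < j+1 has the neighbours m-1 and m+1, which run over 0 .. j-1 and
    over 1 .. j+1; the missing index 0 is the boundary term. *)
Lemma sum_ballotS (R : comNzRingType) n j :
  \sum_(m < j.+1) ballot n.+1 m =
    \sum_(m < j) ballot n m + \sum_(m < j.+2) ballot n m - ballot n 0 :> R.
Proof.
elim: j => [|j IHj].
  by rewrite !big_ord_recr !big_ord0 /= ballotS0; ring.
rewrite big_ord_recr IHj ballotSS /= [in RHS]big_ord_recr.
by rewrite [\sum_(m < j.+3) _]big_ord_recr /=; ring.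
Qed.

(** * A functional adapted to the substitution *)

(** The functional that the n-fold substitution pulls back from [weight 0], where
    [weight 0] is 1 on the letter 0 and -1 on all others. *)
Definition weight {R : nzRingType} (n i : nat) : R :=
  ballot n i - \sum_(m < i) ballot n m.

Lemma weightS (R : comNzRingType) n i :
  weight n.+1 i = \sum_(l <- rho_letter i) weight n l :> R.
Proof.
case: i => [|i]; rewrite /weight !big_cons big_nil ?sum_ballotS.
  by rewrite !big_ord_recr !big_ord0 ballotS0 /=; ring.
by rewrite ballotSS !big_ord_recr !big_ord0 /=; ring.
Qed.

Lemma sum_weight_iter_rho (R : comNzRingType) n w :
  \sum_(i <- iter n rho w) weight 0 i = \sum_(i <- w) weight n i :> R.
Proof.
elim: n w => // n IHn w.
rewrite iterSr IHn /rho big_flatten big_map.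
by apply: eq_bigr => i _; rewrite weightS.
Qed.

(** Images have length 2 for the letter 0 and 3 for all others, so [weight 0] is
    twice the signed difference between 5/2 and the length of the image. *)
Lemma weight0 (R : comNzRingType) i :
  weight 0 i = 5 - 2 * (size (rho_letter i))%:R :> R.
Proof.
rewrite /weight; case: i => [|i]; first by rewrite big_ord0 ballot0 /=; ring.
rewrite big_ord_recl big1 /= => [|m _]; last by rewrite ballot0.
by rewrite !ballot0 /=; ring.
Qed.

Lemma size_rho (R : comNzRingType) w :
  2 * (size (rho w))%:R = 5 * (size w)%:R - \sum_(i <- w) weight 0 i :> R.
Proof.
elim: w => [|i w IHw]; first by rewrite big_nil /=; ring.
rewrite big_cons weight0 /rho /= size_cat natrD mulrDr.
by rewrite [2 * (size (flatten _))%:R]IHw -natr1; ring.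
Qed.

(** The word 0 has weight p_n(0), since the partial sum in [weight n 0] is
    empty. *)
Lemma discrepancyS (R : realType) n :
  discrepancy R n.+1 = 5 / 2 * discrepancy R n - ballot n 0 / 2.
Proof.
have := size_rho R (iter n rho [:: 0%N]).
rewrite sum_weight_iter_rho big_seq1 /weight big_ord0 subr0 -iterS => size_rec.
rewrite /discrepancy exprS.
suff -> : (nletters n.+1)%:R = 5 / 2 * (nletters n)%:R - ballot n 0 / 2 :> R by field.
by rewrite /nletters; lra.
Qed.

Lemma discrepancy_even (R : realType) k :
  discrepancy R k.+1.*2 = 5 / 2 * discrepancy R k.*2.+1.
Proof. by rewrite doubleS discrepancyS ballot_odd; lra. Qed.

Lemma discrepancy_odd (R : realType) k :
  discrepancy R k.+1.*2.+1 =
    25 / 4 * discrepancy R k.*2.+1 - catalan R k.+1 / 2.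
Proof. by rewrite discrepancyS ballot_catalan discrepancy_even; lra. Qed.

(** * Growth of the discrepancy *)

(** Moving the steps +1 and -1 onto 2^-i multiplies it by 1/2 and by 2.  The step
    -1 from 0, absent on the half line, accounts for -2 p_n(0); the terms in K
    are due to the truncation. *)
Lemma sum_ballot_halfS (R : realType) n K :
  \sum_(i < K.+1) ballot n.+1 i / 2 ^+ i =
    5 / 2 * (\sum_(i < K.+1) ballot n i / 2 ^+ i) - 2 * ballot n 0
    + (ballot n K.+1 - ballot n K / 2) / 2 ^+ K :> R.
Proof.
elim: K => [|K IHK].
  by rewrite !big_ord_recl !big_ord0 ballotS0 /=; field.
rewrite big_ord_recr IHK [in RHS]big_ord_recr /= ballotSS exprS.
by field; rewrite expf_neq0.
Qed.

(** Walks of length n end at distance at most n from 0, so for K >= n the sum is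
    over all endpoints; keeping K fixed while n grows makes both sides obey the
    same recurrence, because the truncation terms vanish for n < K. *)
Lemma discrepancy_ballot (R : realType) n K : (n <= K)%N ->
  discrepancy R n = (\sum_(i < K.+1) ballot n i / 2 ^+ i) / 4.
Proof.
elim: n => [_|n IHn n_lt_K].
  rewrite big_ord_recl big1 /= => [|i _]; last by rewrite ballot0 mul0r.
  by rewrite ballot0 /discrepancy /nletters /=; field.
rewrite discrepancyS IHn 1?ltnW // sum_ballot_halfS.
rewrite (ballot_gt R n K.+1) ?(ballot_gt R n K) //; last exact: ltnW.
by field; rewrite expf_neq0.
Qed.

Lemma sum_half_le (R : realType) K : \sum_(i < K) (2 ^+ i)^-1 <= 2 :> R.
Proof.
suff -> : \sum_(i < K) (2 ^+ i)^-1 = 2 - 2 / 2 ^+ K :> R.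
  by rewrite gerBl divr_ge0 ?exprn_ge0.
elim: K => [|K IHK]; first by rewrite big_ord0; field.
by rewrite big_ord_recr IHK /= exprS; field; rewrite expf_neq0.
Qed.

Lemma discrepancy_le (R : realType) n : `|discrepancy R n| <= 2 ^+ n.
Proof.
rewrite (@discrepancy_ballot R n n) // normrM.
suff: `|\sum_(i < n.+1) ballot n i / 2 ^+ i : R| <= 2 ^+ n * 2.
  have := exprn_ge0 n (ler0n R 2); rewrite (gtr0_norm (_ : 0 < 4^-1)) //.
  by move=> *; lra.
apply: le_trans (ler_norm_sum _ _ _) _.
apply: le_trans (ler_wpM2l (exprn_ge0 _ _) (sum_half_le R n.+1)) => //.
rewrite mulr_sumr; apply: ler_sum => i _.
rewrite normrM ler_pM // ?ballot_le // ger0_norm // invr_ge0 exprn_ge0 //.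
Qed.

(** * The Catalan series *)

Lemma sum_catalan_telescope (R : realType) k n :
  \sum_(0 <= j < n) (4 / 25 : R) ^+ j * catalan R (k + 1 + j) =
    25 / 2 * (discrepancy R k.*2.+1
              - (4 / 25) ^+ n * discrepancy R (k + n).*2.+1).
Proof.
elim: n => [|n IHn]; first by rewrite big_nil addn0; ring.
rewrite big_nat_recr //= IHn (addnS k n) discrepancy_odd addn1 addSn exprS.
by field.
Qed.

(** The discrepancy is at most a constant times 4^n here, and
    4 * (4/25) = 16/25 < 1. *)
Lemma discrepancy_vanish (R : realType) k :
  (4 / 25) ^+ n * discrepancy R (k + n).*2.+1 @[n --> \oo] --> (0 : R).
Proof.
pose bound n : R := (16 / 25) ^+ n * 2 ^+ k.*2.+1.
have bound0 : bound n @[n --> \oo] --> (0 : R).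
  rewrite -[0](mul0r (2 ^+ k.*2.+1)); apply: cvgMr_tmp.
  by apply: cvg_expr; rewrite ger0_norm; lra.
apply: norm_cvg0; apply: squeeze_cvgr bound0; last exact: cvg_cst.
near=> n; have pow_ge0 : 0 <= (4 / 25 : R) ^+ n by apply: exprn_ge0; lra.
rewrite normr_ge0 normrM (ger0_norm pow_ge0) /=.
have -> : bound n = (4 / 25) ^+ n * 2 ^+ (k + n).*2.+1.
  have -> : ((k + n).*2.+1 = 2 * n + k.*2.+1)%N by lia.
  rewrite /bound exprD (exprM 2) mulrA -exprMn.
  by congr (_ ^+ _ * _); field.
by rewrite ler_wpM2l ?discrepancy_le.
Unshelve. all: by end_near.
Qed.

Lemma sum_catalan_cvg (R : realType) k :
  (\sum_(0 <= j < n) (4 / 25 : R) ^+ j * catalan R (k + 1 + j))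
    @[n --> \oo] --> 25 / 2 * discrepancy R k.*2.+1.
Proof.
under eq_fun do rewrite sum_catalan_telescope.
apply: cvgMl_tmp.
rewrite -[X in _ --> X]subr0; apply: cvgB; first exact: cvg_cst.
exact: discrepancy_vanish.
Qed.

(** After the index shift i = j + k + 1 this is the previous series times
    (4/25)^(k+1), as (2/5)^2 = 4/25. *)
Lemma sum_catalan_tail_cvg (R : realType) k :
  (\sum_(k.+1 <= i < n) (2 / 5 : R) ^+ (2 * i) * catalan R i)
    @[n --> \oo] --> (4 / 25) ^+ k.+1 * (25 / 2 * discrepancy R k.*2.+1).
Proof.
rewrite -(cvg_shiftn k.+1) /=.
have -> : (fun n => \sum_(k.+1 <= i < n + k.+1)
                      (2 / 5 : R) ^+ (2 * i) * catalan R i) =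
    (fun n => (4 / 25) ^+ k.+1 *
       \sum_(0 <= j < n) (4 / 25 : R) ^+ j * catalan R (k + 1 + j)).
  apply/funext => n; rewrite -{1}[k.+1]add0n big_addn addnK mulr_sumr.
  apply: eq_bigr => j _.
  have -> : (k + 1 + j = j + k.+1)%N by lia.
  rewrite [RHS]mulrA -exprD exprM (addnC k.+1).
  by congr (_ ^+ _ * _); field.
exact: cvgMl_tmp (sum_catalan_cvg R k).
Qed.

Theorem mainTheorem2 (R : realType) :
  (forall k : nat,
    [/\ cvgn (fun n : nat =>
          \sum_(k.+1 <= i < n) (2 / 5 : R) ^+ (2 * i) * catalan R i),
        discrepancy R (2 * k + 1) =
          1 / 2 * (5 / 2) ^+ (2 * k) *
            limn (fun n : nat =>
              \sum_(k.+1 <= i < n) (2 / 5 : R) ^+ (2 * i) * catalan R i),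
        cvgn (fun n : nat =>
          \sum_(0 <= j < n) (4 / 25 : R) ^+ j * catalan R (k + 1 + j)) &
        discrepancy R (2 * k + 1) =
          2 / 25 *
            limn (fun n : nat =>
              \sum_(0 <= j < n) (4 / 25 : R) ^+ j * catalan R (k + 1 + j))])
  /\
  (forall k : nat, (1 <= k)%N ->
    discrepancy R (2 * k) = 5 / 2 * discrepancy R (2 * k - 1)).
Proof.
split=> [k|[//|k] _]; last first.
  by rewrite mul2n discrepancy_even doubleS subn1.
have tail_cvg := @sum_catalan_tail_cvg R k.
have head_cvg := @sum_catalan_cvg R k.
have k_odd : (2 * k + 1 = k.*2.+1)%N by rewrite mul2n addn1.
split.
- by apply/cvg_ex; eexists; exact: tail_cvg.
- rewrite (cvg_lim _ tail_cvg) // k_odd exprM.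
  have -> : (4 / 25 : R) ^+ k.+1 = 4 / 25 * ((5 / 2) ^+ 2 ^+ k)^-1.
    by rewrite exprS -exprVn; congr (_ * _ ^+ _); field.
  by field; rewrite !expf_neq0 //; lra.
- by apply/cvg_ex; eexists; exact: head_cvg.
- by rewrite (cvg_lim _ head_cvg) // k_odd; field.
Qed.
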